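(* Let $n,m,J,p\ge 1$ be integers, $\Psi\in C(\mathbb{R}^n,\mathbb{R}^n)$, $h\in C(\mathbb{R}^n,\mathbb{R}^m)$, $m_0\in\mathbb{R}^n$, and let $C_0,\Sigma\in\mathbb{R}^{n\times n}$, $\Gamma\in\mathbb{R}^{m\times m}$ be symmetric positive-definite. Let $\mu_0$ be the prior measure on $v=(v_0,\dots,v_J)$ and, for two data sets $y,y'\in\mathbb{R}^{J\times m}$, let $\mu,\mu'$ be the corresponding posterior smoothing measures (all defined in the context). Assume that $\mathbb{E}^{\mu_0}\mathsf{v}<\infty$ where $\mathsf{v}:=\sum_{j=1}^{J}(1+|h(v_j)|^2)$. Let $g:\mathbb{R}^n\to\mathbb{R}^p$ be (measurable and) such that $\mathbb{E}^{\mu_0}|g(v_J)|^2<\infty$. Then for every $r>0$ there is $c=c(r)>0$ such that, for all $y,y'$ with $|y|,|y'|<r$, $$|\mathbb{E}^{\mu_J}g(u)-\mathbb{E}^{\mu_J'}g(u)|\le c\,|Y_J-Y_J'|,$$ where $\mu_J$ and $\mu_J'$ denote the filtering distributions at time $J$ corresponding to the data $Y_J=y$, $Y_J'=y'$ respectively, i.e. the marginals of $\mu$ and $\mu'$ on the coordinate $v_J$.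
   Context: For a symmetric positive-definite matrix $A$ write $|x|_A=|A^{-1/2}x|$, where $|\cdot|$ is the Euclidean norm. The underlying model is $v_{j+1}=\Psi(v_j)+\xi_j$, $v_0\sim N(m_0,C_0)$, with $\xi_j\sim N(0,\Sigma)$ i.i.d., and data $y_{j+1}=h(v_{j+1})+\eta_{j+1}$, with $\eta_{j+1}\sim N(0,\Gamma)$ i.i.d., $j=0,\dots,J-1$; $v_0$, $\{\xi_j\}$, $\{\eta_j\}$ are mutually independent. $Y_J=\{y_l\}_{l=1}^J$ is the accumulated data, and the filtering distribution at time $J$ is the distribution of $v_J|Y_J$. For $v=(v_0,\dots,v_J)\in\mathbb{R}^{(J+1)\times n}$ and $y=(y_1,\dots,y_J)\in\mathbb{R}^{J\times m}$ set $$\mathsf{J}(v)=\tfrac12|v_0-m_0|_{C_0}^2+\sum_{j=0}^{J-1}\tfrac12|v_{j+1}-\Psi(v_j)|_\Sigma^2,\qquad \Phi(v;y)=\sum_{j=0}^{J-1}\tfrac12|y_{j+1}-h(v_{j+1})|_\Gamma^2 .$$ The prior $\mu_0$ is the probability measure on $\mathbb{R}^{(J+1)\times n}$ with Lebesgue density proportional to $\exp(-\mathsf{J}(v))$. The posterior $\mu$ (resp. $\mu'$) is the probability measure with density proportional to $\exp(-\mathsf{J}(v)-\Phi(v;y))$ (resp. $\exp(-\mathsf{J}(v)-\Phi(v;y'))$). *)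

(* Defs.v *)
From HB Require Import structures.
From mathcomp Require Import all_boot all_order all_algebra.
From mathcomp Require Import all_classical all_reals all_analysis.
From mathcomp Require Import measurable_realfun.

Set Implicit Arguments.
Unset Strict Implicit.
Unset Printing Implicit Defensive.

Import Order.TTheory GRing.Theory Num.Theory.
Import numFieldNormedType.Exports.

Local Open Scope classical_set_scope.
Local Open Scope ring_scope.

(* Vectors of R^n are row vectors, so matrices act on the right.  A path
   (v_0, ..., v_J) is a (J+1) x n matrix whose row j is v_j; a data set
   (y_1, ..., y_J) is a J x m matrix whose row j (numbered from 0) is y_{j+1}. *)

Definition mx_display : measure_display.
Proof. exact. Qed.

(* The Borel sigma-algebra of R^{k x n}. *)
Section borel_mx.
Context {R : realType} {k n : nat}.
Local Notation M := 'M[R]_(k, n).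

HB.instance Definition _ := @isMeasurable.Build mx_display M <<s @open M >>
  (@sigma_algebra0 _ setT _) (@sigma_algebraC _ _)
  (@sigma_algebra_bigcup _ setT _).

Lemma open_measurable_mx (A : set M) : open A -> measurable A.
Proof. by move=> oA; apply: sub_sigma_algebra. Qed.

Lemma continuous_coord_mx (i : 'I_k) (j : 'I_n) :
  continuous (fun A : M => A i j).
Proof.
move=> A B nB; exists (fun i' j' => if (i' == i) && (j' == j) then B else setT).
  move=> i' j'; case: ifPn => [/andP[/eqP-> /eqP->]//|_]; exact: filterT.
by move=> C /(_ i j); rewrite !eqxx.
Qed.

Lemma continuous_measurable_mxR (f : M -> R) :
  continuous f -> measurable_fun [set: M] f.
Proof.
move=> /continuousP cf.
apply: (@measurability _ _ _ _ _ _ _ (RGenOpens.measurableE R)).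
move=> _ [_ [a [b ->]] <-]; rewrite setTI; apply: open_measurable_mx.
exact/cf/interval_open.
Qed.

Lemma measurable_coord_mx (i : 'I_k) (j : 'I_n) :
  measurable_fun [set: M] (fun A : M => A i j).
Proof. by apply: continuous_measurable_mxR; exact: continuous_coord_mx. Qed.

Lemma measurable_mxP d (T : measurableType d) (f : T -> M) :
  (forall i j, measurable_fun setT (fun x => f x i j)) ->
  measurable_fun setT f.
Proof.
move=> mf; apply: (@measurability _ _ _ _ _ _ (@open M)) => // _ [U oU <-].
rewrite setTI.
pose box (q : 'M[rat]_(k, n)) (N : nat) : set M :=
  [set A | forall i j, `|A i j - ratr (q i j)| < N.+1%:R^-1].
have mbox q N : measurable (f @^-1` box q N).
  rewrite (_ : _ @^-1` _ = \bigcap_(ij in [set: 'I_k * 'I_n])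
      [set x | `|f x ij.1 ij.2 - ratr (q ij.1 ij.2)| < N.+1%:R^-1]).
    apply: fin_bigcap_measurable; first exact: finite_finset.
    move=> [i j] _ /=.
    have : measurable_fun setT (fun x => `|f x i j - ratr (q i j)| < N.+1%:R^-1).
      apply: measurable_fun_ltr => //.
      apply: measurableT_comp; first exact: normr_measurable.
      exact: measurable_funB.
    by move=> /(_ measurableT [set true]); rewrite setTI; exact.
  by rewrite predeqE => x; split=> [h [i j] _|h i j]; [exact: h|exact: (h (i, j))].
rewrite (_ : _ @^-1` _ = \bigcup_(qN : 'M[rat]_(k, n) * nat)
    if `[< box qN.1 qN.2 `<=` U >] then f @^-1` box qN.1 qN.2 else set0).
  apply: countable_bigcupT_measurable; first exact: countableP.
  by move=> qN; case: ifPn.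
rewrite predeqE => x; split=> [Ufx|[[q N] _ /=]]; last first.
  by case: ifPn => // /asboolP sub /sub.
have /nbhs_ballP[e /= e0 eU] : nbhs (f x) U by exact: open_nbhs_nbhs.
have [N _ Ne] := near_infty_natSinv_lt (PosNum (divr_gt0 e0 (ltr0n R 2))).
have {}Ne := Ne N (leqnn _).
have /= N0 : 0 < N.+1%:R^-1 :> R by rewrite invr_gt0.
have hq i j : exists q : rat, `|f x i j - ratr q| < N.+1%:R^-1.
  have /rat_in_itvoo[q] : f x i j - N.+1%:R^-1 < f x i j + N.+1%:R^-1.
    by rewrite ltrBlDr -addrA ltrDl addr_gt0.
  rewrite in_itv/= => /andP[h1 h2]; exists q.
  by rewrite distrC ltr_distl h1 h2.
exists (\matrix_(i, j) sval (cid (hq i j)), N) => //=.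
have xq : box (\matrix_(i, j) sval (cid (hq i j))) N (f x).
  by move=> i j; rewrite mxE; case: cid.
case: ifPn => // /asboolPn; apply: contra_notP => _ A Aq.
apply: eU; split=> // i j.
rewrite /ball/= (splitr e).
have -> : f x i j - A i j = (f x i j - ratr (sval (cid (hq i j)))) -
                        (A i j - ratr (sval (cid (hq i j)))).
  by rewrite opprB addrA subrK.
rewrite (le_lt_trans (ler_normB _ _))// ltrD//.
  by have := xq i j; rewrite mxE => /lt_trans; apply.
by have := Aq i j; rewrite mxE => /lt_trans; apply.
Qed.

End borel_mx.

Lemma continuous_measurable_mx (R : realType) (k n k' n' : nat)
    (f : 'M[R]_(k, n) -> 'M[R]_(k', n')) :
  continuous f -> measurable_fun setT f.
Proof.
move=> /continuousP cf; apply: (@measurability _ _ _ _ _ _ (@open 'M[R]_(k', n'))) => //.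
move=> _ [U oU <-]; rewrite setTI; apply: open_measurable_mx; exact: cf.
Qed.

(* Lebesgue measure on R^n, by iterating the product with the Lebesgue measure
   of R, and on R^{k x n}, seen as R^{kn}. *)
Section lebesgue_rV.
Context {R : realType}.

Lemma sigma_finite_product d d' (T : measurableType d) (T' : measurableType d')
    (m1 : {sigma_finite_measure set T -> \bar R})
    (m2 : {sigma_finite_measure set T' -> \bar R}) :
  sigma_finite setT (m1 \x m2)%E.
Proof.
have /sigma_finiteP[F [TF ndF Foo]] := sigma_finiteT m1.
have /sigma_finiteP[G [TG ndG Goo]] := sigma_finiteT m2.
exists (fun n => F n `*` G n).
  rewrite -setXTT TF TG predeqE => -[x y]; split.
    move=> [/= [i _ Fix] [j _ Gjy]]; exists (maxn i j) => //; split.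
    - by move: x Fix; exact/subsetPset/ndF/leq_maxl.
    - by move: y Gjy; exact/subsetPset/ndG/leq_maxr.
  by move=> [i _ []/= ? ?]; split; exists i.
move=> i; have [? ?] := Foo i; have [? ?] := Goo i.
split; first exact: measurableX.
by rewrite product_measure1E// lte_mul_pinfty// ge0_fin_numE.
Qed.

Lemma sigma_finite_pushforward d d' (T : measurableType d)
    (T' : measurableType d') (mu : set T -> \bar R) (f : T -> T') (g : T' -> T) :
  sigma_finite setT mu -> measurable_fun setT g -> cancel f g ->
  sigma_finite setT (pushforward mu f).
Proof.
move=> [F FT mF] mg fK; exists (fun i => g @^-1` F i).
  by rewrite -preimage_bigcup -FT preimage_setT.
move=> i; have [mFi oFi] := mF i; split.
  by rewrite -[X in measurable X]setTI; exact: mg.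
rewrite /pushforward -comp_preimage (_ : g \o f = id) ?preimage_id//.
exact/funext.
Qed.

Definition rV_cons n (p : measurableTypeR R * 'rV[R]_n) : 'rV[R]_n.+1 :=
  row_mx (p.1 : R)%:M p.2.

Definition rV_uncons n (v : 'rV[R]_n.+1) : measurableTypeR R * 'rV[R]_n :=
  (v ord0 ord0, rsubmx (v : 'rV_(1 + n))).

Lemma rV_consK n : cancel (@rV_cons n) (@rV_uncons n).
Proof.
move=> [x v]; rewrite /rV_cons /rV_uncons row_mxKr; congr pair.
transitivity (row_mx (x : R)%:M v ord0 (lshift n (ord0 : 'I_1))).
  by congr (fun_of_matrix _ _ _); exact: val_inj.
by rewrite row_mxEl mxE.
Qed.

Lemma measurable_rV_cons n : measurable_fun setT (@rV_cons n).
Proof.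
apply: measurable_mxP => i j; rewrite /rV_cons.
case: (@split_ordP 1 n j) => l ->.
  have -> : (fun x : measurableTypeR R * 'rV[R]_n =>
      row_mx (x.1 : R)%:M x.2 i (lshift n l)) = fst.
    by apply/funext => x; rewrite row_mxEl !ord1 mxE.
  exact: measurable_fst.
have -> : (fun x : measurableTypeR R * 'rV[R]_n =>
    row_mx (x.1 : R)%:M x.2 i (rshift 1 l)) = (fun v : 'rV[R]_n => v i l) \o snd.
  by apply/funext => x; rewrite row_mxEr.
apply: measurableT_comp => //; exact: measurable_coord_mx.
Qed.

Lemma measurable_rV_uncons n : measurable_fun setT (@rV_uncons n).
Proof.
apply/measurable_fun_pairP; split; first exact: measurable_coord_mx.
apply: measurable_mxP => i j.
rewrite (_ : (fun _ => _) = fun v : 'rV[R]_(1 + n) => v i (rshift 1 j)).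
  exact: measurable_coord_mx.
by apply/funext => v; rewrite /= mxE.
Qed.

Section cons_measure.
Context {n : nat} (lam : {sigma_finite_measure set 'rV[R]_n -> \bar R}).

Definition lebesgue_rV_cons :=
  pushforward (lebesgue_measure \x lam)%E (@rV_cons n).

HB.instance Definition _ := Measure.copy lebesgue_rV_cons
  (measure_function_pushforward__canonical__measure_function_Measure
    (lebesgue_measure \x lam)%E (@measurable_rV_cons n)).

HB.instance Definition _ := Measure_isSigmaFinite.Build _ _ _ lebesgue_rV_cons
  (sigma_finite_pushforward (sigma_finite_product lebesgue_measure lam)
    (@measurable_rV_uncons n) (@rV_consK n)).

End cons_measure.

Fixpoint lebesgue_rV n : {sigma_finite_measure set 'rV[R]_n -> \bar R} :=
  if n is n'.+1 then lebesgue_rV_cons (lebesgue_rV n') else \d_(0 : 'rV[R]_0).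

Lemma measurable_vec_mx k n : measurable_fun setT (@vec_mx R k n).
Proof.
apply: measurable_mxP => i j.
rewrite (_ : (fun _ => _) = fun v : 'rV[R]_(k * n) => v ord0 (mxvec_index i j)).
  exact: measurable_coord_mx.
by apply/funext => v; rewrite mxE.
Qed.

Lemma measurable_mxvec k n : measurable_fun setT (@mxvec R k n).
Proof.
apply: measurable_mxP => i j; case/mxvec_indexP: j => a b.
rewrite (_ : (fun _ => _) = fun A : 'M[R]_(k, n) => A a b).
  exact: measurable_coord_mx.
by apply/funext => A; rewrite ord1 mxvecE.
Qed.

Definition lebesgue_mx {k n} : set 'M[R]_(k, n) -> \bar R :=
  pushforward (lebesgue_rV (k * n)) vec_mx.

HB.instance Definition _ k n := Measure.copy (@lebesgue_mx k n)
  (measure_function_pushforward__canonical__measure_function_Measure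
    (lebesgue_rV (k * n)) (@measurable_vec_mx k n)).

HB.instance Definition _ k n :=
  Measure_isSigmaFinite.Build _ _ _ (@lebesgue_mx k n)
    (sigma_finite_pushforward (sigma_finiteT (lebesgue_rV (k * n)))
      (@measurable_mxvec k n) (@vec_mxK R k n)).

End lebesgue_rV.

Section gibbs.
Context {R : realType} {k n : nat} (U : {mfun 'M[R]_(k, n) >-> R}).

Definition gibbs_measure (A : set 'M[R]_(k, n)) : \bar R :=
  (\int[lebesgue_mx]_(v in A) (expR (- U v))%:E)%E.

Let gibbs_measure0 : gibbs_measure set0 = 0%E.
Proof. exact: integral_set0. Qed.

Let gibbs_measure_ge0 A : (0 <= gibbs_measure A)%E.
Proof. by apply: integral_ge0 => v _; rewrite lee_fin expR_ge0. Qed.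

Let gibbs_measure_sigma_additive : semi_sigma_additive gibbs_measure.
Proof.
apply: semi_sigma_additive_nng_induced => [|v]; last by rewrite lee_fin expR_ge0.
apply/measurable_EFinP; apply: measurableT_comp; first exact: measurable_expR.
exact: measurableT_comp.
Qed.

HB.instance Definition _ := isMeasure.Build _ _ _ gibbs_measure
  gibbs_measure0 gibbs_measure_ge0 gibbs_measure_sigma_additive.

(* The probability measure with Lebesgue density proportional to exp(-U).  The
   second argument of mnormalize is a default that is used only when the integral
   of exp(-U) is 0 or infinite. *)
Definition gibbs : probability 'M[R]_(k, n) R :=
  mnormalize gibbs_measure (dirac (0 : 'M[R]_(k, n))).

End gibbs.

(* Euclidean norm; `|x| is the sup norm on matrices. *)
Definition enorm {R : realType} {k n : nat} (x : 'M[R]_(k, n)) : R :=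
  Num.sqrt (\sum_i \sum_j x i j ^+ 2).

Definition spdmx {R : realType} {n : nat} (A : 'M[R]_n) : Prop :=
  A^T = A /\ forall x : 'rV[R]_n, x != 0 -> 0 < (x *m A *m x^T) ord0 ord0.

(* A^{1/2}: the unique symmetric positive-definite square root.  The default 0 of
   xget is used only when A is not symmetric positive-definite. *)
Definition sqrtmx {R : realType} {n : nat} (A : 'M[R]_n) : 'M[R]_n :=
  xget 0 [set B | spdmx B /\ B *m B = A].

(* |x|_A = |A^{-1/2} x|, with x a row vector and A^{-1/2} symmetric. *)
Definition wnorm {R : realType} {n : nat} (A : 'M[R]_n) (x : 'rV[R]_n) : R :=
  enorm (x *m invmx (sqrtmx A)).

Lemma measurable_enorm (R : realType) k n :
  measurable_fun setT (@enorm R k n).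
Proof.
apply: measurableT_comp.
  by apply: continuous_measurable_fun; exact: sqrt_continuous.
apply: measurable_sum => i; apply: measurable_sum => j.
apply: measurable_funX; exact: measurable_coord_mx.
Qed.

Lemma measurable_wnorm (R : realType) n (A : 'M[R]_n) :
  measurable_fun setT (wnorm A).
Proof.
apply: measurableT_comp; first exact: measurable_enorm.
apply: measurable_mxP => i j.
rewrite (_ : (fun _ => _) =
  fun x : 'rV[R]_n => \sum_l x i l * invmx (sqrtmx A) l j); last first.
  by apply/funext => x; rewrite mxE.
apply: measurable_sum => l; apply: measurable_funM => //.
exact: measurable_coord_mx.
Qed.

Lemma measurable_row (R : realType) k n (i : 'I_k) :
  measurable_fun setT (@row R k n i).
Proof.
apply: measurable_mxP => a b.
rewrite (_ : (fun _ => _) = fun A : 'M[R]_(k, n) => A i b).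
  exact: measurable_coord_mx.
by apply/funext => A; rewrite mxE.
Qed.

HB.instance Definition _ (R : realType) k n (i : 'I_k) :=
  isMeasurableFun.Build _ _ _ _ (@row R k n i) (@measurable_row R k n i).

Section model.
Context {R : realType} {n m J : nat}.
Variables (Psi : continuousType 'rV[R]_n 'rV[R]_n).
Variables (h : continuousType 'rV[R]_n 'rV[R]_m).
Variables (m0 : 'rV[R]_n) (C0 Sigma : 'M[R]_n) (Gamma : 'M[R]_m).
Implicit Types (v : 'M[R]_(J.+1, n)) (y : 'M[R]_(J, m)).

(* J(v), the negative log-density of the prior up to a constant; row 0 of v is
   v_0, and lift ord0 j is the index j + 1. *)
Definition prior_potential v : R :=
  2^-1 * wnorm C0 (row ord0 v - m0) ^+ 2 +
  \sum_(j < J) 2^-1 * wnorm Sigma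
    (row (lift ord0 j) v - Psi (row (widen_ord (leqnSn J) j) v)) ^+ 2.

(* Phi(v; y) *)
Definition misfit y v : R :=
  \sum_(j < J) 2^-1 * wnorm Gamma (row j y - h (row (lift ord0 j) v)) ^+ 2.

Let measurable_wnormB d (T : measurableType d) l (A : 'M[R]_l)
    (f g : T -> 'rV[R]_l) :
  measurable_fun setT f -> measurable_fun setT g ->
  measurable_fun setT (fun x => 2^-1 * wnorm A (f x - g x) ^+ 2).
Proof.
move=> mf mg; apply: measurable_funM => //; apply: measurable_funX.
apply: measurableT_comp; first exact: measurable_wnorm.
apply: measurable_mxP => i j.
rewrite (_ : (fun _ => _) = fun x => f x i j - g x i j); last first.
  by apply/funext => x; rewrite !mxE.
have mc (f' : T -> 'rV[R]_l) : measurable_fun setT f' ->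
    measurable_fun setT ((fun B : 'rV[R]_l => B i j) \o f').
  by apply: measurableT_comp; exact: measurable_coord_mx.
by apply: measurable_funB; exact: mc.
Qed.

Lemma measurable_prior_potential : measurable_fun setT prior_potential.
Proof.
apply: measurable_funD.
  by apply: measurable_wnormB => //; exact: measurable_row.
apply: measurable_sum => j; apply: measurable_wnormB; first exact: measurable_row.
apply: measurableT_comp; last exact: measurable_row.
by apply: continuous_measurable_mx; exact: cts_fun.
Qed.

Lemma measurable_misfit y : measurable_fun setT (misfit y).
Proof.
apply: measurable_sum => j; apply: measurable_wnormB => //.
apply: measurableT_comp; last exact: measurable_row.
by apply: continuous_measurable_mx; exact: cts_fun.
Qed.

HB.instance Definition _ :=
  isMeasurableFun.Build _ _ _ _ prior_potential measurable_prior_potential.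
HB.instance Definition _ y :=
  isMeasurableFun.Build _ _ _ _ (misfit y) (measurable_misfit y).

Definition prior : probability 'M[R]_(J.+1, n) R := gibbs prior_potential.

Definition posterior y : probability 'M[R]_(J.+1, n) R :=
  gibbs (prior_potential \+ misfit y).

(* The marginal of the posterior on v_J. *)
Definition filtering y : probability 'rV[R]_n R :=
  distribution (posterior y) (row (ord_max : 'I_J.+1)).

(* The sum over j = 1, ..., J of 1 + |h(v_j)|^2. *)
Definition obs_growth v : R :=
  \sum_(j < J) (1 + enorm (h (row (lift ord0 j) v)) ^+ 2).

End model.
Arguments prior {R n} J Psi m0 C0 Sigma.

Definition vexpectation {R : realType} {n p : nat} (P : probability 'rV[R]_n R)
    (g : 'rV[R]_n -> 'rV[R]_p) : 'rV[R]_p :=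
  \row_i fine 'E_P[fun u => g u ord0 i].

(* Main.v *)
Require Import Defs.
From mathcomp Require Import all_boot all_order all_algebra.
From mathcomp Require Import all_classical all_reals all_analysis.
From mathcomp Require Import measurable_realfun.
From mathcomp Require Import complex spectral ring lra.

Import Order.TTheory GRing.Theory Num.Theory.
Import numFieldNormedType.Exports.

Local Open Scope classical_set_scope.
Local Open Scope ring_scope.

Set Implicit Arguments.
Unset Strict Implicit.
Unset Printing Implicit Defensive.

(* The posterior is the prior [P] tilted by the weight [exp (- Phi)], so the two
   filtering means are ratios N / Z and N' / Z' of [P]-integrals.  As
   [|exp (- a) - exp (- b)| <= |a - b|] for nonnegative a, b, and
   [|g| |Phi(v; y) - Phi(v; y')|] is at most [|y - y'|] times a multiple of
   [D = 2 + |g(v_J)|^2 + obs_growth], which is [P]-integrable, numerators and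
   denominators are Lipschitz in the data; the denominators are bounded below by
   [E exp (- B D) > 0] because [Phi <= B D] uniformly over [|y| < r].

   That the prior really has the density [exp (- J) / Z] requires [0 < Z < oo]:
   finiteness follows from the coercivity of [wnorm], which rests on the
   existence of the square root of a positive-definite matrix (a polynomial in
   the matrix interpolating the square root on its spectrum), and from integrating
   out the coordinates from the last to the first, each of them being Gaussian
   given the previous ones. *)

(** * Square roots of symmetric positive-definite matrices *)

(** Newton interpolation: at a new node x, a multiple of the product of the X - z over the earlier
    nodes z corrects the value without disturbing the others. *)
Lemma poly_interpolation (F : fieldType) (s : seq F) (f : F -> F) :
  exists q : {poly F}, forall x, x \in s -> q.[x] = f x.
Proof.
elim: s => [|x s [q qE]]; first by exists 0.
have [xs|xs] := boolP (x \in s).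
  by exists q => z; rewrite inE => /predU1P[->|]; exact: qE.
pose w := \prod_(z <- s) ('X - z%:P).
have wx : w.[x] != 0.
  by rewrite -[_ == 0]/(root w x) root_prod_XsubC.
exists (q + ((f x - q.[x]) / w.[x]) *: w) => z; rewrite inE hornerD hornerZ.
move=> /predU1P[->|zs]; first by rewrite divfK// addrC subrK.
have : root w z by rewrite root_prod_XsubC.
by rewrite rootE => /eqP ->; rewrite mulr0 addr0 qE.
Qed.

Lemma horner_mx_eigen (F : fieldType) n (A : 'M[F]_n.+1) (u : 'rV_n.+1) a p :
  u *m A = a *: u -> u *m horner_mx A p = p.[a] *: u.
Proof.
move=> uA; elim/poly_ind: p => [|p c ihp].
  by rewrite rmorph0 mulmx0 horner0 scale0r.
rewrite rmorphD rmorphM/= horner_mx_X horner_mx_C mulmxDr mulmxA.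
by rewrite ihp -scalemxAl uA scalerA mul_mx_scalar !hornerE scalerDl.
Qed.

Lemma tr_horner_mx (F : fieldType) n (A : 'M[F]_n.+1) p :
  A^T = A -> (horner_mx A p)^T = horner_mx A p.
Proof.
move=> sA; elim/poly_ind: p => [|p c ihp]; first by rewrite rmorph0 trmx0.
rewrite rmorphD rmorphM/= horner_mx_X horner_mx_C linearD/= tr_scalar_mx.
rewrite [in LHS]trmx_mul sA ihp; congr (_ + _).
transitivity (horner_mx A ('X * p)); first by rewrite rmorphM/= horner_mx_X.
by rewrite mulrC rmorphM/= horner_mx_X.
Qed.

Lemma tr_quad_gt0 (R : realFieldType) n (x : 'rV[R]_n) :
  x != 0 -> 0 < (x *m x^T) ord0 ord0.
Proof.
move=> x0; rewrite mxE lt_neqAle; apply/andP; split; last first.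
  by apply: sumr_ge0 => i _; rewrite mxE -expr2 sqr_ge0.
apply: contra x0; rewrite eq_sym psumr_eq0 => [/allP h|i _]; last first.
  by rewrite mxE -expr2 sqr_ge0.
apply/eqP/rowP => i; have /= := h i (mem_index_enum _).
by rewrite !mxE mulf_eq0 orbb => /eqP.
Qed.

Lemma spdmx_eigen_gt0 (R : realType) n (A : 'M[R]_n) (u : 'rV_n) a :
  spdmx A -> u != 0 -> u *m A = a *: u -> 0 < a.
Proof.
move=> [_ Apos] u0 uA; have := Apos _ u0.
by rewrite uA -scalemxAl mxE pmulr_lgt0// tr_quad_gt0.
Qed.

(** A nonzero row of the kernel would be an eigenvector for the eigenvalue 0, which positivity
    forbids. *)
Lemma spdmx_unit (R : realType) n (A : 'M[R]_n) : spdmx A -> A \in unitmx.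
Proof.
move=> spdA; rewrite -row_free_unit -kermx_eq0; apply/eqP/row_matrixP => i.
rewrite row0; apply/eqP; apply: contraT => i0.
have : row i (kermx A) *m A = 0 *: row i (kermx A).
  by rewrite scale0r -row_mul mulmx_ker row0.
by move/(spdmx_eigen_gt0 spdA i0); rewrite ltxx.
Qed.

Section complex_spectrum.
Local Open Scope complex_scope.

(** A real symmetric matrix is Hermitian over R[i], so the complex spectral theorem gives real
    eigenvalues and an invertible matrix of eigenvectors. *)
Lemma spdmx_spectrum (R : realType) n (A : 'M[R]_n) : spdmx A ->
  exists (P : 'M[R[i]]_n) (d : 'I_n -> R), [/\ P \in unitmx,
    forall k, 0 < d k &
    forall k, row k P *m map_mx (real_complex R) A = (d k)%:C *: row k P].
Proof.
move=> spdA; have [sA _] := spdA.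
pose AC := map_mx (real_complex R) A.
have rAC : AC \is a mxOver Num.real.
  by apply/mxOverP => i j; rewrite mxE complex_real.
have hAC : AC \is hermsymmx.
  apply: realsym_hermsym => //; apply/is_hermitianmxP.
  by rewrite expr0 scale1r map_mx_id// map_trmx sA.
have nAC := hermitian_normalmx hAC.
pose P := spectralmx AC; pose sp := spectral_diag AC.
have Pu : P \in unitmx by exact: spectral_unit.
have ACE : AC = invmx P *m diag_mx sp *m P by exact/orthomx_spectralP.
pose d k := complex.Re (sp ord0 k).
have dE k : sp ord0 k = (d k)%:C.
  have /mxOverP/(_ ord0 k) := hermitian_spectral_diag_real hAC.
  by move=> /RRe_real ->.
have eig k : row k P *m AC = (d k)%:C *: row k P.
  rewrite ACE -row_mul !mulmxA mulmxV// mul1mx; apply/rowP => j.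
  by rewrite mul_diag_mx !mxE dE.
exists P, d; split => // k.
(* As [d k] is real, the real and imaginary parts of the eigenvector are real vectors scaled by A by
   the same factor. One of them is nonzero since [P] is invertible, and positive-definiteness
   applies to it. *)
pose a := \row_j complex.Re (P k j); pose b := \row_j complex.Im (P k j).
have aA : a *m A = d k *: a.
  apply/rowP => j; have /rowP/(_ j) := eig k; rewrite mxE.
  move/(congr1 (@complex.Re R)); rewrite !mxE raddf_sum.
  rewrite (_ : complex.Re ((d k)%:C * _) = d k * complex.Re (P k j)); last first.
    by case: (P k j) => x y /=; rewrite mul0r subr0.
  move=> <-; apply: eq_bigr => l _; rewrite !mxE.
  by case: (P k l) => x y /=; rewrite mulr0 subr0.
have bA : b *m A = d k *: b.
  apply/rowP => j; have /rowP/(_ j) := eig k; rewrite mxE.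
  move/(congr1 (@complex.Im R)); rewrite !mxE raddf_sum.
  rewrite (_ : complex.Im ((d k)%:C * _) = d k * complex.Im (P k j)); last first.
    by case: (P k j) => x y /=; rewrite mul0r addr0.
  move=> <-; apply: eq_bigr => l _; rewrite !mxE.
  by case: (P k l) => x y /=; rewrite mulr0 add0r.
have [a0|a0] := eqVneq a 0; last exact: spdmx_eigen_gt0 aA.
have [b0|b0] := eqVneq b 0; last exact: spdmx_eigen_gt0 bA.
have : row k P = 0.
  apply/rowP => j; move/rowP: a0 => /(_ j); move/rowP: b0 => /(_ j).
  by rewrite !mxE; case: (P k j) => x y /= -> ->.
move/(congr1 (mulmx^~ (invmx P))); rewrite -row_mul mulmxV// mul0mx.
by move=> /rowP/(_ k)/eqP; rewrite !mxE eqxx oner_eq0.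
Qed.

End complex_spectrum.

(** The polynomial interpolates the fourth root: Q = q(A) is symmetric with Q^4 = A, so the root Q^2
    = Q Q^T is positive-definite at once, because x Q Q^T x^T = |x Q|^2 and Q is invertible. *)
Lemma spdmx_sqrt (R : realType) n (A : 'M[R]_n) :
  spdmx A -> exists B, spdmx B /\ B *m B = A.
Proof.
case: n A => [|n] A spdA.
  exists A; split => //; apply/matrixP; by case.
have [sA _] := spdA.
have [P [d [Pu d0 eig]]] := spdmx_spectrum spdA.
have [q qE] := poly_interpolation [seq d k | k : 'I_n.+1] (Num.sqrt \o Num.sqrt).
pose Q := horner_mx A q.
have sQ : Q^T = Q by exact: tr_horner_mx.
have Q4 : Q *m Q *m (Q *m Q) = A.
  (* The equality is tested over R[i] on the rows of the invertible [P], on which Q acts as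
     multiplication by the fourth root of [d k]. *)
  apply: (map_mx_inj (f := real_complex R)).
  apply: (can_inj (mulKmx Pu)); apply/row_matrixP => k; rewrite !row_mul eig.
  have QE : row k P *m map_mx (real_complex R) Q
      = real_complex R (Num.sqrt (Num.sqrt (d k))) *: row k P.
    rewrite map_horner_mx (horner_mx_eigen _ (eig k)) horner_map qE//.
    exact/map_f/mem_enum.
  rewrite !map_mxM !mulmxA QE -!scalemxAl QE -!scalemxAl QE -!scalemxAl QE.
  rewrite !scalerA -!rmorphM/=; congr (real_complex R _ *: _).
  rewrite -mulrA -!expr2 sqr_sqrtr ?sqrtr_ge0// sqr_sqrtr//.
  exact/ltW/d0.
have Qu : Q \in unitmx.
  by have := spdmx_unit spdA; rewrite -Q4 !unitmx_mul => /andP[/andP[]].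
exists (Q *m Q); split => //; split; first by rewrite trmx_mul sQ.
move=> x x0; rewrite mulmxA -[X in _ *m X *m _]sQ -mulmxA -trmx_mul.
apply: tr_quad_gt0; apply: contra x0 => /eqP /(congr1 (mulmx^~ (invmx Q))).
by rewrite mulmxK// mul0mx => ->.
Qed.

(** Existence of a root makes [xget] return one instead of its default. *)
Lemma sqrtmxP (R : realType) n (A : 'M[R]_n) :
  spdmx A -> spdmx (sqrtmx A) /\ sqrtmx A *m sqrtmx A = A.
Proof.
move=> /spdmx_sqrt [B hB].
exact: (@xgetPex _ 0 [set C | spdmx C /\ C *m C = A] (ex_intro _ B hB)).
Qed.

(** * Norm comparisons and coercivity of the weighted norm *)

Lemma sqr_enorm (R : realType) k n (x : 'M[R]_(k, n)) :
  enorm x ^+ 2 = \sum_i \sum_j x i j ^+ 2.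
Proof.
rewrite sqr_sqrtr//; apply: sumr_ge0 => i _; apply: sumr_ge0 => j _.
exact: sqr_ge0.
Qed.

Lemma enorm_ge0 (R : realType) k n (x : 'M[R]_(k, n)) : 0 <= enorm x.
Proof. exact: sqrtr_ge0. Qed.

Lemma ler_coord_enorm (R : realType) k n (x : 'M[R]_(k, n)) i j :
  `|x i j| <= enorm x.
Proof.
rewrite -(@ler_pXn2r _ 2)// ?nnegrE ?enorm_ge0// sqr_enorm real_normK ?num_real//.
rewrite (bigD1 i)//= (bigD1 j)//= -addrA lerDl addr_ge0//.
  by apply: sumr_ge0 => l _; exact: sqr_ge0.
by apply: sumr_ge0 => l _; apply: sumr_ge0 => l' _; exact: sqr_ge0.
Qed.

(** This crude norm serves twice: it dominates [enorm], and it bounds the coordinates of x M by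
    those of x. *)
Definition mx_l1 (R : realType) k n (A : 'M[R]_(k, n)) : R :=
  \sum_i \sum_j `|A i j|.

Lemma mx_l1_ge0 (R : realType) k n (A : 'M[R]_(k, n)) : 0 <= mx_l1 A.
Proof. by apply: sumr_ge0 => i _; apply: sumr_ge0. Qed.

Lemma enorm_le_l1 (R : realType) k n (x : 'M[R]_(k, n)) : enorm x <= mx_l1 x.
Proof.
rewrite -(@ler_pXn2r _ 2)// ?nnegrE ?enorm_ge0 ?mx_l1_ge0// sqr_enorm.
rewrite expr2 {1}/mx_l1 mulr_suml; apply: ler_sum => i _.
rewrite mulr_suml; apply: ler_sum => j _.
rewrite -real_normK ?num_real// expr2 ler_wpM2l//.
rewrite /mx_l1 (bigD1 i)//= (bigD1 j)//= -addrA lerDl addr_ge0//.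
  by apply: sumr_ge0.
by apply: sumr_ge0 => l _; apply: sumr_ge0.
Qed.

Lemma ler_mulmx_l1 (R : realType) n p (x : 'rV[R]_n) (M : 'M[R]_(n, p)) t j :
  (forall l, `|x ord0 l| <= t) -> `|(x *m M) ord0 j| <= t * mx_l1 M.
Proof.
move=> xt; rewrite mxE (le_trans (ler_norm_sum _ _ _))// mulr_sumr.
apply: ler_sum => l _; rewrite normrM.
have t0 : 0 <= t by exact: le_trans (xt l).
rewrite ler_pM// (bigD1 j)//= lerDl; exact: sumr_ge0.
Qed.

(** With B = A^(1/2) and y = x B^(-1), the identity x = y B gives |x|^2 <= K |y|^2, and |y| is
    [wnorm A x]. *)
Lemma wnorm_coercive (R : realType) n (A : 'M[R]_n) : spdmx A ->
  exists2 a : R, 0 < a & forall x, a * enorm x ^+ 2 <= 2^-1 * wnorm A x ^+ 2.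
Proof.
move=> /sqrtmxP[/spdmx_unit Bu _]; set B := sqrtmx A in Bu.
pose K := n%:R * mx_l1 B ^+ 2.
have K0 : 0 <= K by rewrite mulr_ge0// exprn_ge0// mx_l1_ge0.
(* K is only known to be nonnegative; adding 1 keeps the denominator positive. *)
exists (2 * (K + 1))^-1 => [|x]; first by rewrite invr_gt0; lra.
rewrite /wnorm -/B; set y := x *m invmx B.
have xE : x = y *m B by rewrite mulmxKV.
have xy : enorm x ^+ 2 <= K * enorm y ^+ 2.
  rewrite [in leLHS]sqr_enorm big_ord1 /K -mulrA -exprMn.
  have -> : n%:R * (mx_l1 B * enorm y) ^+ 2 = \sum_(j < n) (mx_l1 B * enorm y) ^+ 2.
    by rewrite sumr_const card_ord mulr_natl.
  apply: ler_sum => j _; rewrite -[leLHS]real_normK ?num_real//.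
  rewrite lerXn2r ?nnegrE ?mulr_ge0 ?mx_l1_ge0 ?enorm_ge0// mulrC xE.
  by apply: ler_mulmx_l1 => l; exact: ler_coord_enorm.
rewrite invfM -mulrA ler_pM2l ?invr_gt0// ler_pdivrMl; last by lra.
by rewrite (le_trans xy)// ler_wpM2r ?sqr_ge0// lerDl.
Qed.

(** * Gaussian integrals over vectors and matrices, one coordinate at a time *)

(** The integrand is a multiple of the normal density of mean c and variance 1 / (2 a). Independence
    of c is what allows centres that depend on other coordinates. *)
Lemma integral_gaussian (R : realType) (a : R) : 0 < a ->
  exists I : R, forall c : R,
    (\int[lebesgue_measure]_x (expR (- (a * (x - c) ^+ 2)))%:E = I%:E)%E.
Proof.
move=> a0; pose s := Num.sqrt (2 * a)^-1.
have s0 : 0 < s by rewrite sqrtr_gt0 invr_gt0 mulr_gt0.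
exists (normal_peak s)^-1 => c.
have p0 : 0 < normal_peak s by rewrite normal_peak_gt0// gt_eqF.
transitivity (\int[lebesgue_measure]_x
    ((normal_peak s)^-1%:E * (normal_pdf c s x)%:E))%E.
  apply: eq_integral => x _; rewrite normal_pdfE ?gt_eqF// -EFinM.
  rewrite mulKf ?gt_eqF// /normal_fun sqr_sqrtr ?invr_ge0 ?mulr_ge0 ?ltW//.
  congr (expR _)%:E; have := lt0r_neq0 a0; set y := (x - c) => a0'.
  by field.
rewrite ge0_integralZl//=; last 3 first.
- by apply/measurable_EFinP; exact: measurable_normal_pdf.
- by move=> x _; rewrite lee_fin normal_pdf_ge0.
- by rewrite lee_fin invr_ge0 ltW.
by rewrite integral_normal_pdf mule1.
Qed.

Lemma rV_cons0 (R : realType) n (x : R) (w : 'rV[R]_n) :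
  rV_cons (x : measurableTypeR R, w) ord0 ord0 = x.
Proof. by have /(congr1 fst) := rV_consK (x : measurableTypeR R, w). Qed.

Lemma rV_cons_lift (R : realType) n (x : R) (w : 'rV[R]_n) (k : 'I_n) :
  rV_cons (x : measurableTypeR R, w) ord0 (lift ord0 k) = w ord0 k.
Proof.
have /(congr1 snd)/rowP/(_ k) := rV_consK (x : measurableTypeR R, w).
by rewrite /= mxE => <-; congr (_ _ _); exact: val_inj.
Qed.

Lemma ge0_integral_rV_cons (R : realType) n (f : 'rV[R]_n.+1 -> \bar R) :
  measurable_fun setT f -> (forall v, 0 <= f v)%E ->
  (\int[lebesgue_rV n.+1]_v f v =
   \int[lebesgue_measure]_x \int[lebesgue_rV n]_w f (rV_cons (x, w)))%E.
Proof.
move=> mf f0.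
rewrite [LHS](ge0_integral_pushforward (@measurable_rV_cons R n))//.
rewrite preimage_setT fubini_tonelli1//.
- by apply: measurableT_comp => //; exact: measurable_rV_cons.
- by move=> x; exact: f0.
Qed.

(* Integrating the last coordinate first, every factor contributes I. *)
Lemma integral_triangular_prod (R : realType) (G : R -> R) (I : R) :
  measurable_fun setT G -> (forall x, 0 <= G x) ->
  (forall c, \int[lebesgue_measure]_x (G (x - c))%:E = I%:E)%E ->
  forall n (c : 'I_n -> 'rV[R]_n -> R),
  (forall k, measurable_fun setT (c k)) ->
  (forall (k : 'I_n) (v w : 'rV[R]_n),
    (forall l : 'I_n, (l < k)%N -> v ord0 l = w ord0 l) -> c k v = c k w) ->
  (\int[lebesgue_rV n]_v (\prod_k G (v ord0 k - c k v))%:E = (I ^+ n)%:E)%E.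
Proof.
move=> mG G0 GI; elim=> [c _ _|n ih c mc cE].
  under eq_integral do rewrite big_ord0.
  by rewrite integral_cst//= diracT mule1 expr0.
have mf : measurable_fun setT
    (fun v : 'rV[R]_n.+1 => \prod_k G (v ord0 k - c k v)).
  apply: measurable_prod => k _; apply: measurableT_comp => //.
  by apply: measurable_funB; [exact: measurable_coord_mx|exact: mc].
rewrite ge0_integral_rV_cons; last 2 first.
- exact/measurable_EFinP.
- by move=> v; rewrite lee_fin; apply: prodr_ge0.
pose c0 := c ord0 0.
transitivity (\int[lebesgue_measure]_x ((G (x - c0))%:E * (I ^+ n)%:E))%E.
  apply: eq_integral => x _.
  (* For a fixed head x the remaining centres form a triangular family in one dimension less, so the
     tail integrates to I^n whatever x is. *)
  pose c' (k : 'I_n) (w : 'rV[R]_n) :=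
    c (lift ord0 k) (rV_cons (x : measurableTypeR R, w)).
  have mc' k : measurable_fun setT (c' k).
    apply: (measurableT_comp (mc _)).
    apply: (measurableT_comp (@measurable_rV_cons R n)).
    exact: pair1_measurable.
  rewrite -(ih c')//; last first.
    move=> k v w vw; apply: cE => l.
    have [j ->|->] := unliftP ord0 l; last by rewrite !rV_cons0.
    by rewrite !rV_cons_lift /= /bump !add1n ltnS => /vw.
  rewrite -ge0_integralZl//=; last 3 first.
  - apply/measurable_EFinP; apply: measurable_prod => k _.
    apply: measurableT_comp => //.
    by apply: measurable_funB; [exact: measurable_coord_mx|exact: mc'].
  - by move=> v _; rewrite lee_fin; apply: prodr_ge0.
  - by rewrite lee_fin.
  apply: eq_integral => w _; rewrite -EFinM big_ord_recl rV_cons0.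
  (* The first centre depends on no coordinate at all, so it may be evaluated at 0. *)
  rewrite (cE _ _ 0)//; congr (_ * _)%:E; apply: eq_bigr => k _.
  by rewrite rV_cons_lift.
rewrite ge0_integralZr//=; last 3 first.
- apply/measurable_EFinP; apply: measurableT_comp => //.
  exact: measurable_funB.
- by move=> v _; rewrite lee_fin.
(* I is nonnegative, being the integral of G. *)
- rewrite lee_fin exprn_ge0// -lee_fin -(GI 0).
  by apply: integral_ge0 => x _; rewrite lee_fin.
by rewrite GI -EFinM exprS.
Qed.

Lemma index_allpairs_pair (S T : eqType) (s : seq S) (t : seq T) x y :
  x \in s -> y \in t ->
  index (x, y) [seq (a, b) | a <- s, b <- t] = (index x s * size t + index y t)%N.
Proof.
move=> + yt; elim: s => //= a s ih; rewrite inE index_cat eq_sym.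
have [->|ax /= xs] := eqVneq a x => /=.
  by rewrite map_f// index_map//= => u v [].
case: ifPn => [/mapP[b _ [xa]]|_]; first by rewrite xa eqxx in ax.
by rewrite size_map ih// mulSn addnA.
Qed.

(** [mxvec_index] is the rank in the enumeration of pairs, which runs row by row. Hence earlier rows
    occupy earlier coordinates of the vectorized matrix. *)
Lemma val_mxvec_index k n (i : 'I_k) (j : 'I_n) :
  mxvec_index i j = (i * n + j)%N :> nat.
Proof.
have <- : index (i, j) (enum {: 'I_k * 'I_n}) = mxvec_index i j.
  rewrite -[X in index X](enum_rankK (i, j)) (enum_val_nth (i, j)).
  by rewrite index_uniq ?enum_uniq// -cardE.
rewrite enumT unlock /= /prod_enum index_allpairs_pair ?mem_enum//.
by rewrite !index_enum_ord size_enum_ord.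
Qed.

Lemma ltn_mxvec_index k n (i i' : 'I_k) (j j' : 'I_n) :
  (i < i')%N -> (mxvec_index i j < mxvec_index i' j')%N.
Proof.
move=> ii'; rewrite !val_mxvec_index (@leq_trans (i.+1 * n))//.
  by rewrite mulSn addnC ltn_add2r.
by rewrite (leq_trans _ (leq_addr _ _))// leq_mul2r ii' orbT.
Qed.

(** Vectorizing row by row turns dependence on earlier rows into dependence on earlier coordinates,
    which reduces the claim to row vectors. *)
Lemma integral_triangular_prod_mx (R : realType) (G : R -> R) (I : R) :
  measurable_fun setT G -> (forall x, 0 <= G x) ->
  (forall c, \int[lebesgue_measure]_x (G (x - c))%:E = I%:E)%E ->
  forall k n (c : 'I_k -> 'M[R]_(k, n) -> 'rV[R]_n),
  (forall i, measurable_fun setT (c i)) ->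
  (forall (i : 'I_k) (v w : 'M[R]_(k, n)),
    (forall l : 'I_k, (l < i)%N -> row l v = row l w) -> c i v = c i w) ->
  (\int[lebesgue_mx]_v (\prod_i \prod_j G (v i j - c i v ord0 j))%:E
   = (I ^+ (k * n))%:E)%E.
Proof.
move=> mG G0 GI k n c mc cE.
have mf : measurable_fun setT
    (fun v : 'M[R]_(k, n) => \prod_i \prod_j G (v i j - c i v ord0 j)).
  apply: measurable_prod => i _; apply: measurable_prod => j _.
  apply: measurableT_comp => //.
  apply: measurable_funB; first exact: measurable_coord_mx.
  exact: (measurableT_comp (@measurable_coord_mx R 1 n ord0 j) (mc i)).
rewrite (ge0_integral_pushforward (@measurable_vec_mx R k n))//; last 2 first.
- exact/measurable_EFinP.
- by move=> v _; rewrite lee_fin; apply: prodr_ge0 => i _; apply: prodr_ge0.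
rewrite preimage_setT.
pose dec (l : 'I_(k * n)) : 'I_k * 'I_n :=
  enum_val (cast_ord (esym (mxvec_cast k n)) l).
have decE i j : dec (mxvec_index i j) = (i, j).
  by rewrite /dec cast_ordK enum_rankK.
pose c' l (u : 'rV[R]_(k * n)) := c (dec l).1 (vec_mx u) ord0 (dec l).2.
have mc' l : measurable_fun setT (c' l).
  apply: (measurableT_comp (@measurable_coord_mx R 1 n ord0 (dec l).2)).
  by apply: (measurableT_comp (mc _)); exact: measurable_vec_mx.
rewrite -(integral_triangular_prod mG G0 GI mc'); last first.
  move=> l v w; case/mxvec_indexP: l => i j vw.
  rewrite /c' decE/=; congr (fun_of_matrix _ _ _); apply: cE => l li.
  by apply/rowP => j'; rewrite !mxE vw//; exact: ltn_mxvec_index.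
apply: eq_integral => u _ /=; congr (_%:E).
rewrite pair_big/= (reindex (uncurry (@mxvec_index k n)))/=; last first.
  exact: curry_mxvec_bij.
by apply: eq_bigr => -[i j] _ /=; rewrite /c' decE mxE.
Qed.

(** * Positivity and finiteness of the normalizing constants *)

Lemma lebesgue_rV_setT_gt0 (R : realType) n :
  (0 < lebesgue_rV (R := R) n setT)%E.
Proof.
elim: n => [|n ih]; first by rewrite /= diracT lte01.
rewrite /= /lebesgue_rV_cons /pushforward preimage_setT -setXTT.
rewrite product_measure1E// mule_gt0//.
have := @lebesgue_measure_itv R `]-oo, +oo[; rewrite /= set_itvNyy => ->.
by rewrite addye// ltry.
Qed.

Lemma lebesgue_mx_setT_gt0 (R : realType) k n :
  (0 < lebesgue_mx (R := R) (k := k) (n := n) setT)%E.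
Proof.
by rewrite /lebesgue_mx /pushforward preimage_setT lebesgue_rV_setT_gt0.
Qed.

(** If the integral were 0, f would vanish almost everywhere; as f vanishes nowhere, the whole space
    would be negligible. *)
Lemma integral_pos_gt0 d (T : measurableType d) (R : realType)
    (mu : {measure set T -> \bar R}) (f : T -> R) :
  (0 < mu setT)%E -> measurable_fun setT f -> (forall x, 0 < f x) ->
  (0 < \int[mu]_x (f x)%:E)%E.
Proof.
move=> mu0 mf f0; rewrite lt_neqAle; apply/andP; split; last first.
  by apply: integral_ge0 => x _; rewrite lee_fin ltW.
apply: contraTneq mu0 => h.
have mf' : measurable_fun setT (EFin \o f) by exact/measurable_EFinP.
rewrite -leNgt le_eqVlt; apply/orP; left; apply/eqP/negligibleP => //.
have /ae_eq_integral_abs : (\int[mu]_x `|(EFin \o f) x| = 0)%E.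
  by rewrite h; apply: eq_integral => v _; rewrite /= ger0_norm// ltW.
move=> /(_ measurableT mf'); apply: negligibleS => x _ /= /(_ I)[].
by apply/eqP; rewrite gt_eqF.
Qed.

Lemma gibbs_measure_setT_gt0 (R : realType) k n
    (U : {mfun 'M[R]_(k, n) >-> R}) : (0 < gibbs_measure U setT)%E.
Proof.
apply: integral_pos_gt0 => [||v]; last exact: expR_gt0.
  exact: lebesgue_mx_setT_gt0.
apply: measurableT_comp; first exact: measurable_expR.
exact: measurableT_comp.
Qed.

Lemma measurable_expRN d (T : measurableType d) (R : realType) (U : T -> R) :
  measurable_fun setT U -> measurable_fun setT (fun x => expR (- U x)).
Proof.
move=> mU; apply: measurableT_comp; first exact: measurable_expR.
exact: measurableT_comp.
Qed.

(** Coercivity bounds exp (- J(v)) by a product of one-dimensional Gaussian factors whose centres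
    depend on earlier rows only; the triangular integral of that product is finite. *)
Lemma prior_evidence_lty (R : realType) (n J : nat)
    (Psi : continuousType 'rV[R]_n 'rV[R]_n) (m0 : 'rV[R]_n)
    (C0 Sigma : 'M[R]_n) : spdmx C0 -> spdmx Sigma ->
  (gibbs_measure (@prior_potential R n J Psi m0 C0 Sigma) setT < +oo)%E.
Proof.
move=> /wnorm_coercive[a0 a0_gt0 C0E] /wnorm_coercive[a1 a1_gt0 SE].
(* The smaller of the two coercivity constants serves all rows. *)
pose a := Num.min a0 a1.
have a_gt0 : 0 < a by rewrite lt_min a0_gt0.
have [I GI] := integral_gaussian a_gt0.
(* Row 0 is centred at m_0 and row j + 1 at Psi(v_j); [unlift ord0] separates the two cases and
   lowers the index by one. *)
pose c (i : 'I_J.+1) (v : 'M[R]_(J.+1, n)) :=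
  if unlift ord0 i is Some i' then Psi (row (widen_ord (leqnSn J) i') v) else m0.
have mc i : measurable_fun setT (c i).
  rewrite /c; case: unliftP => [j _|_] //.
  apply: measurableT_comp; last exact: measurable_row.
  by apply: continuous_measurable_mx; exact: cts_fun.
pose G (x : R) := expR (- (a * x ^+ 2)).
have mG : measurable_fun setT G.
  by apply: measurable_expRN; apply: measurable_funM.
have G0 x : 0 <= G x by exact: expR_ge0.
have cE (i : 'I_J.+1) (v w : 'M[R]_(J.+1, n)) :
    (forall l : 'I_J.+1, (l < i)%N -> row l v = row l w) -> c i v = c i w.
  by rewrite /c; case: unliftP => [j ij|//] vw; rewrite vw// ij /= /bump add1n.

rewrite /gibbs_measure.
apply: (@le_lt_trans _ _ (I ^+ (J.+1 * n))%:E); last exact: ltry.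
rewrite -(integral_triangular_prod_mx mG G0 GI mc cE).
apply: ge0_le_integral => //.
- apply/measurable_EFinP/measurable_expRN; exact: measurable_prior_potential.
- apply/measurable_EFinP; apply: measurable_prod => i _.
  apply: measurable_prod => j _; apply: measurableT_comp => //.
  apply: measurable_funB; first exact: measurable_coord_mx.
  exact: (measurableT_comp (@measurable_coord_mx R 1 n ord0 j) (mc i)).
move=> v _; rewrite lee_fin.
under eq_bigr do rewrite -expR_sum.
rewrite -expR_sum ler_expR.
under eq_bigr do rewrite sumrN -mulr_sumr.
rewrite sumrN lerN2 big_ord_recl /prior_potential lerD//.
  rewrite {1}/c unlift_none (le_trans _ (C0E _))// sqr_enorm big_ord1.
  apply: ler_pM => //; first exact: ltW.
  - by apply: sumr_ge0 => j _; exact: sqr_ge0.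
  - by rewrite ge_min lexx.
  - by apply: ler_sum => j _; rewrite !mxE.
apply: ler_sum => j _.
rewrite {1}/c liftK (le_trans _ (SE _))// sqr_enorm big_ord1.
apply: ler_pM => //; first exact: ltW.
- by apply: sumr_ge0 => l _; exact: sqr_ge0.
- by rewrite ge_min lexx orbT.
- by apply: ler_sum => l _; rewrite !mxE.
Qed.

(** * Integration against a measure given by a density *)

Section density.
Import HBNNSimple.
Local Open Scope ereal_scope.
Context d (T : measurableType d) (R : realType).
Variables (mu nu : {measure set T -> \bar R}) (w : T -> R).
Hypotheses (mw : measurable_fun setT w) (w0 : forall x, (0 <= w x)%R).
Hypothesis nuE : forall A, measurable A -> nu A = \int[mu]_(x in A) (w x)%:E.

(** A simple function is a finite combination of indicators of its level sets, and for indicators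
    the claim is [nuE]. *)
Lemma integral_density_nnsfun (g : {nnsfun T >-> R}) :
  \int[nu]_x (g x)%:E = \int[mu]_x (g x * w x)%:E.
Proof.
have gE x : (g x)%:E = \sum_(r \in range g) (r * \1_(g @^-1` [set r]) x)%:E.
  by rewrite [in LHS]fimfunE -fsumEFin.
under eq_integral do rewrite gE.
rewrite ge0_integral_fsum//; last 2 first.
- by move=> r; exact/measurable_EFinP/measurable_funM.
- by move=> r x _; rewrite EFinM nnfun_muleindic_ge0.
under [RHS]eq_integral.
  move=> x _; rewrite EFinM gE ge0_mule_fsuml; last first.
    by move=> r; rewrite EFinM nnfun_muleindic_ge0.
  over.
rewrite [RHS]ge0_integral_fsum//; last 2 first.
- move=> r; rewrite (_ : (fun _ => _) =
    (fun x => (r * \1_(g @^-1` [set r]) x * w x)%:E))//.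
  by apply/measurable_EFinP; do 2 apply: measurable_funM => //.
- by move=> r x _; rewrite -EFinM lee_fin mulr_ge0// -lee_fin EFinM nnfun_muleindic_ge0.
apply: eq_fsbigr => r rg.
have r0 : (0 <= r)%R by move: rg; rewrite inE => -[x _ <-].
transitivity (r%:E * nu (g @^-1` [set r])).
  rewrite -[in RHS](setIT (g @^-1` [set r])) -integral_indic//.
  rewrite -ge0_integralZl//.
  - exact/measurable_EFinP.
rewrite nuE// integral_mkcond -ge0_integralZl//.
- apply: eq_integral => x _; rewrite epatch_indic /=.
  by rewrite -!EFinM mulrAC mulrA.
- have mr : measurable (g @^-1` [set r]) by [].
  apply/(measurable_restrictT (fun x => (w x)%:E) mr).
  by apply: measurable_funTS; exact/measurable_EFinP.
- by move=> x _; rewrite erestrict_ge0// => ? _; rewrite lee_fin.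
Qed.

(** Monotone convergence applies on both sides to simple approximations of f; w >= 0 keeps the
    products increasing. *)
Lemma ge0_integral_density (f : T -> R) : measurable_fun setT f ->
  (forall x, (0 <= f x)%R) -> \int[nu]_x (f x)%:E = \int[mu]_x (f x * w x)%:E.
Proof.
move=> mf f0; have mf' : measurable_fun setT (EFin \o f) by exact/measurable_EFinP.
pose f_ := nnsfun_approx measurableT mf'.
have cf x : (f_ n x)%:E @[n --> \oo] --> (f x)%:E.
  by apply: cvg_nnsfun_approx => // y _; rewrite lee_fin.
transitivity (limn (fun n => \int[nu]_x (f_ n x)%:E)).
  rewrite -monotone_convergence//=.
  - by apply: eq_integral => x _; apply/esym/cvg_lim => //.
  - by move=> n; exact/measurable_EFinP.
  - by move=> n x _; rewrite lee_fin.
  - by move=> x _ a b ab; rewrite lee_fin//; exact/lefP/nd_nnsfun_approx.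
transitivity (limn (fun n => \int[mu]_x (f_ n x * w x)%:E)).
  by congr (limn _); apply/funext => n; exact: integral_density_nnsfun.
rewrite -monotone_convergence//=.
- apply: eq_integral => x _; apply/cvg_lim => //.
  under eq_fun do rewrite EFinM.
  by rewrite EFinM; apply: cvgeZr.
- by move=> n; exact/measurable_EFinP/measurable_funM.
- by move=> n x _; rewrite lee_fin mulr_ge0.
- move=> x _ a b ab; rewrite lee_fin// ler_wpM2r//.
  exact/lefP/nd_nnsfun_approx.
Qed.

(** As w >= 0, taking positive and negative parts commutes with multiplication by w. *)
Lemma integral_density (f : T -> R) : measurable_fun setT f ->
  \int[nu]_x (f x)%:E = \int[mu]_x (f x * w x)%:E.
Proof.
move=> mf; rewrite integralE [RHS]integralE; congr (_ - _).
- transitivity (\int[nu]_x (Num.max (f x) 0)%:E).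
    by apply: eq_integral => x _; rewrite funeposE EFin_max.
  rewrite ge0_integral_density//.
  + apply: eq_integral => x _; rewrite funeposE -EFin_max.
    by rewrite maxr_pMl// mul0r.
  + exact: measurable_maxr.
  + by move=> x; rewrite le_max lexx orbT.
- transitivity (\int[nu]_x (Num.max (- f x) 0)%:E).
    by apply: eq_integral => x _; rewrite funenegE EFin_max EFinN.
  rewrite ge0_integral_density//.
  + apply: eq_integral => x _; rewrite funenegE -EFinN -EFin_max.
    by rewrite maxr_pMl// mul0r mulNr.
  + by apply: measurable_maxr => //; exact: measurableT_comp.
  + by move=> x; rewrite le_max lexx orbT.
Qed.

End density.

(** * Gibbs measures and their tilting by an added potential *)

Section gibbs_tilt.
Local Open Scope ereal_scope.
Context (R : realType) (k n : nat).
Variable U : {mfun 'M[R]_(k, n) >-> R}.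
Hypothesis Uoo : gibbs_measure U setT < +oo.

(** The total mass lies strictly between 0 and +oo, so [mnormalize] divides by it instead of
    returning its default. *)
Lemma gibbsE A : gibbs U A =
  gibbs_measure U A * ((fine (gibbs_measure U setT))^-1)%:E.
Proof.
have U0 := gibbs_measure_setT_gt0 U.
by rewrite /gibbs /= /mnormalize gt_eqF// lt_eqF.
Qed.

Lemma gibbs_density A : measurable A -> gibbs U A =
  \int[lebesgue_mx]_(v in A) (expR (- U v) / fine (gibbs_measure U setT))%:E.
Proof.
move=> mA; rewrite gibbsE; set Z := ((fine (gibbs_measure U setT))^-1)%R.
rewrite /gibbs_measure.
have Z0 : (0 <= Z)%R by rewrite invr_ge0 fine_ge0.
under [RHS]eq_integral do rewrite EFinM.
rewrite ge0_integralZr//.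
by apply/measurable_EFinP/measurable_funTS; exact: measurable_expRN.
Qed.

Lemma integral_gibbs (f : 'M[R]_(k, n) -> R) : measurable_fun setT f ->
  \int[gibbs U]_v (f v)%:E =
  \int[lebesgue_mx]_v (f v * (expR (- U v) / fine (gibbs_measure U setT)))%:E.
Proof.
apply: (@integral_density _ _ _ lebesgue_mx) => [|v|].
- by apply: measurable_funM => //; exact: measurable_expRN.
- by rewrite mulr_ge0 ?expR_ge0// invr_ge0 fine_ge0.
- exact: gibbs_density.
Qed.


Variables (V : {mfun 'M[R]_(k, n) >-> R}) (phi : 'M[R]_(k, n) -> R).
Hypotheses (phi0 : forall v, (0 <= phi v)%R).
Hypothesis VE : forall v, (V v = U v + phi v)%R.

Lemma gibbs_measure_addr_lty : gibbs_measure V setT < +oo.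
Proof.
apply: le_lt_trans Uoo; apply: ge0_le_integral => //.
- by apply/measurable_EFinP; exact: measurable_expRN.
- by apply/measurable_EFinP; exact: measurable_expRN.
- by move=> v _; rewrite lee_fin ler_expR lerN2 VE lerDl.
Qed.

End gibbs_tilt.

Section gibbs_add.
Context (R : realType) (k n : nat).
Variables (U V : {mfun 'M[R]_(k, n) >-> R}) (phi : 'M[R]_(k, n) -> R).
Hypothesis Uoo : (gibbs_measure U setT < +oo)%E.
Hypotheses (mphi : measurable_fun setT phi) (phi0 : forall v, 0 <= phi v).
Hypothesis VE : forall v, V v = U v + phi v.

Let Z := (\int[gibbs U]_v expR (- phi v)).
Let ZU := fine (gibbs_measure U setT).
Let ZV := fine (gibbs_measure V setT).

Let Voo : (gibbs_measure V setT < +oo)%E.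
Proof. exact: gibbs_measure_addr_lty VE. Qed.

Let ZU_gt0 : 0 < ZU.
Proof. by rewrite fine_gt0// gibbs_measure_setT_gt0. Qed.

Let ZV_gt0 : 0 < ZV.
Proof. by rewrite fine_gt0// gibbs_measure_setT_gt0. Qed.

Let ZE : Z = ZV / ZU.
Proof.
rewrite /Z /Rintegral integral_gibbs//; last exact: measurable_expRN.
under eq_integral do rewrite mulrA -expRD -opprD addrC -VE EFinM.
rewrite ge0_integralZr//=.
- rewrite fineM//.
  rewrite ge0_fin_numE ?Voo//.
  by apply: integral_ge0 => v _; rewrite lee_fin expR_ge0.
- by apply/measurable_EFinP; exact: measurable_expRN.
- by rewrite lee_fin invr_ge0 fine_ge0.
Qed.

(** Both sides become Lebesgue integrals. Since Z = ZV / ZU, the density exp (- U) / ZU times exp (-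
    phi) / Z is exp (- V) / ZV. *)
Lemma integral_gibbs_add (f : 'M[R]_(k, n) -> R) : measurable_fun setT f ->
  (\int[gibbs V]_v (f v)%:E =
   \int[gibbs U]_v (f v * (expR (- phi v) / Z))%:E)%E.
Proof.
move=> mf.
have mf' : measurable_fun setT (fun v => f v * (expR (- phi v) / Z)).
  apply: measurable_funM => //; apply: measurable_funM => //.
  exact: measurable_expRN.
rewrite (integral_gibbs Voo mf) (integral_gibbs Uoo mf').
apply: eq_integral => v _; rewrite -/ZU -/ZV ZE VE opprD expRD; congr (_%:E).
move: (expR (- U v)) (expR (- phi v)) (f v) ZU_gt0 ZV_gt0 => a b c u0 v0.
by field; rewrite !gt_eqF.
Qed.

End gibbs_add.

(** * Lipschitz dependence of a tilted mean on the tilting potential *)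

Section ratio.
Context d (T : measurableType d) (R : realType) (P : probability T R).
Variable D : T -> R.
Hypotheses (intD : P.-integrable setT (EFin \o D)).

Lemma integrable_expRN (f phi : T -> R) :
  measurable_fun setT f -> measurable_fun setT phi ->
  (forall x, 0 <= phi x) -> (forall x, `|f x| <= D x) ->
  P.-integrable setT (EFin \o (fun x => f x * expR (- phi x))).
Proof.
move=> mf mphi phi0 fD; apply: (le_integrable _ _ _ intD) => //.
  by apply/measurable_EFinP; apply: measurable_funM => //; exact: measurable_expRN.
move=> x _ /=; rewrite lee_fin normrM [`|expR _|]ger0_norm ?expR_ge0//.
rewrite (le_trans _ (ler_norm _))// (le_trans _ (fD x))// ler_piMr//.
by rewrite -expR0 ler_expR oppr_le0.
Qed.

(** For a <= b the difference is exp (- a) (1 - exp (- (b - a))); the first factor is at most 1 and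
    the second at most b - a, by exp t >= 1 + t. *)
Lemma ler_norm_expRNB (a b : R) : 0 <= a -> 0 <= b ->
  `|expR (- a) - expR (- b)| <= `|a - b|.
Proof.
wlog ab : a b / a <= b => [hw|] a0 b0.
  have [/hw|/ltW/hw hba] := leP a b; first by apply.
  by rewrite distrC [leRHS]distrC hba.
rewrite ger0_norm ?subr_ge0 ?ler_expR ?lerN2// distrC ger0_norm ?subr_ge0//.
rewrite (_ : - b = - a - (b - a)); last by ring.
rewrite expRD -[X in X - _]mulr1 -mulrBr.
have e1 := expR_ge1Dx (- (b - a)).
have ea : expR (- a) <= 1 by rewrite -expR0 ler_expR oppr_le0.
have e0 := expR_ge0 (- a).
have e2 : expR (- (b - a)) <= 1 by rewrite -expR0 ler_expR oppr_le0 subr_ge0.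
apply: (@le_trans _ _ (1 - expR (- (b - a)))); last lra.
by rewrite ler_piMl// subr_ge0.
Qed.

(** [D] dominates f, which gives integrability, and e D dominates the change of the integrand, which
    gives the bound. *)
Lemma ler_dist_expRN_integral (f phi phi' : T -> R) (e : R) :
  measurable_fun setT f -> measurable_fun setT phi -> measurable_fun setT phi' ->
  (forall x, 0 <= phi x) -> (forall x, 0 <= phi' x) ->
  (forall x, `|f x| <= D x) ->
  (forall x, `|f x| * `|phi x - phi' x| <= e * D x) ->
  `|\int[P]_x (f x * expR (- phi x)) - \int[P]_x (f x * expR (- phi' x))|
    <= e * \int[P]_x D x.
Proof.
move=> mf mphi mphi' phi0 phi'0 fD feD.
have int1 := integrable_expRN mf mphi phi0 fD.
have int2 := integrable_expRN mf mphi' phi'0 fD.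
have intB : P.-integrable setT
   (EFin \o (fun x => f x * expR (- phi x) - f x * expR (- phi' x))).
  exact: integrableB int1 int2.
rewrite -RintegralB// (le_trans (le_normr_Rintegral _ _))//.
rewrite -RintegralZl//; apply: le_Rintegral => //.
- by apply: integrable_norm.
- exact: (integrableZl measurableT e intD).
move=> x _; rewrite -mulrBr normrM (le_trans _ (feD x))// ler_wpM2l//.
exact: ler_norm_expRNB.
Qed.

(** A quotient N / Z is Lipschitz where Z >= z > 0: with M the mean of [D], numerators are at most M
    in absolute value, and numerator and denominator each move by at most e M. *)
Lemma ler_dist_tilted_mean (f phi phi' : T -> R) (e z : R) :
  measurable_fun setT f -> measurable_fun setT phi -> measurable_fun setT phi' ->
  (forall x, 0 <= phi x) -> (forall x, 0 <= phi' x) ->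
  (forall x, 1 <= D x) -> (forall x, `|f x| <= D x) ->
  (forall x, `|f x| * `|phi x - phi' x| <= e * D x) ->
  (forall x, `|phi x - phi' x| <= e * D x) ->
  0 < z -> z <= \int[P]_x expR (- phi x) -> z <= \int[P]_x expR (- phi' x) ->
  `|(\int[P]_x (f x * expR (- phi x))) / (\int[P]_x expR (- phi x)) -
    (\int[P]_x (f x * expR (- phi' x))) / (\int[P]_x expR (- phi' x))|
  <= e * ((\int[P]_x D x) / z + (\int[P]_x D x) ^+ 2 / z ^+ 2).
Proof.
move=> mf mphi mphi' phi0 phi'0 D1 fD feD eD z0.
have NB := ler_dist_expRN_integral mf mphi mphi' phi0 phi'0 fD feD.
(* The denominators are the case f = 1 of the estimate just used. *)
have D1' (x : T) : `|cst 1 x : R| <= D x by rewrite normr1.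
have eD1 (x : T) : `|cst 1 x : R| * `|phi x - phi' x| <= e * D x.
  by rewrite normr1 mul1r.
have := ler_dist_expRN_integral (@measurable_cst _ _ _ _ setT (1 : R))
  mphi mphi' phi0 phi'0 D1' eD1.
under eq_Rintegral do rewrite mul1r.
under [X in _ - X]eq_Rintegral do rewrite mul1r.
have N' : `|\int[P]_x (f x * expR (- phi' x))| <= \int[P]_x D x.
  have int2 := integrable_expRN mf mphi' phi'0 fD.
  rewrite (le_trans (le_normr_Rintegral _ _))//; apply: le_Rintegral => //.
    exact: integrable_norm.
  move=> x _; rewrite normrM [`|expR _|]ger0_norm ?expR_ge0//.
  rewrite (le_trans _ (fD x))// ler_piMr//.
  by rewrite -expR0 ler_expR oppr_le0.
move: NB N'; set N := (\int[P]_x (f x * expR (- phi x))).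
set N' := (\int[P]_x (f x * expR (- phi' x))); set M := \int[P]_x D x.
set Z := \int[P]_x expR (- phi x); set Z' := \int[P]_x expR (- phi' x).
move=> NB NM ZB zZ zZ'.
have Z0 : 0 < Z by exact: lt_le_trans zZ.
have Z'0 : 0 < Z' by exact: lt_le_trans zZ'.
(* The first term contributes e M / z and the second, a product of N' and Z' - Z, contributes e M^2
   / z^2. *)
have -> : N / Z - N' / Z' = (N - N') / Z + N' * (Z' - Z) / (Z * Z').
  by field; rewrite !gt_eqF.
rewrite (le_trans (ler_normD _ _))// [leRHS]mulrDr; apply: lerD.
  rewrite normrM normfV (gtr0_norm Z0) mulrA; apply: ler_pM => //.
    by rewrite invr_ge0 ltW.
  by rewrite lef_pV2.
rewrite !normrM normfV normrM (gtr0_norm Z0) (gtr0_norm Z'0) [leRHS]mulrA.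
apply: ler_pM; first by rewrite mulr_ge0.
- by rewrite invr_ge0 ltW// mulr_gt0.
- by rewrite expr2 mulrCA; apply: ler_pM => //; rewrite distrC.
rewrite lef_pV2 ?posrE ?mulr_gt0// ?exprn_gt0// expr2.
by apply: ler_pM => //; exact: ltW.
Qed.

End ratio.

(** * Growth and Lipschitz bounds for the misfit *)

Section misfit_bounds.
Context (R : realType) (n m J : nat).
Variables (h : continuousType 'rV[R]_n 'rV[R]_m) (Gamma : 'M[R]_m).
Let K := mx_l1 (invmx (sqrtmx Gamma)).
Implicit Types (y : 'M[R]_(J, m)) (v : 'M[R]_(J.+1, n)).

Lemma misfit_ge0 y v : 0 <= misfit h Gamma y v.
Proof. by apply: sumr_ge0 => j _; rewrite mulr_ge0// sqr_ge0. Qed.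

Lemma wnorm_sqr_le (a : 'rV[R]_m) t : (forall l, `|a ord0 l| <= t) ->
  wnorm Gamma a ^+ 2 <= m%:R * (t * K) ^+ 2.
Proof.
move=> at_; rewrite /wnorm sqr_enorm big_ord1.
have -> : m%:R * (t * K) ^+ 2 = \sum_(l < m) (t * K) ^+ 2.
  by rewrite sumr_const card_ord mulr_natl.
apply: ler_sum => l _; rewrite -[leLHS]real_normK ?num_real//.
have := ler_mulmx_l1 (invmx (sqrtmx Gamma)) l at_.
rewrite -/K => e1; rewrite ler_sqr ?nnegrE//.
exact: le_trans e1.
Qed.

(** Each coordinate contributes a difference of squares after multiplication by Gamma^(-1/2): the
    difference factor is at most s K, the sum factor at most 2 t K. *)
Lemma wnorm_sqr_dist (a b : 'rV[R]_m) s t :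
  (forall l, `|a ord0 l| <= t) -> (forall l, `|b ord0 l| <= t) ->
  (forall l, `|(a - b) ord0 l| <= s) ->
  `|wnorm Gamma a ^+ 2 - wnorm Gamma b ^+ 2| <= m%:R * ((s * K) * (2 * (t * K))).
Proof.
move=> at_ bt abs; rewrite /wnorm !sqr_enorm !big_ord1 -sumrB.
rewrite (le_trans (ler_norm_sum _ _ _))//.
have -> : m%:R * ((s * K) * (2 * (t * K))) = \sum_(l < m) (s * K) * (2 * (t * K)).
  by rewrite sumr_const card_ord mulr_natl.
apply: ler_sum => l _; rewrite subr_sqr normrM.
have := ler_mulmx_l1 (invmx (sqrtmx Gamma)) l at_.
have := ler_mulmx_l1 (invmx (sqrtmx Gamma)) l bt.
have := ler_mulmx_l1 (invmx (sqrtmx Gamma)) l abs.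
rewrite mulmxBl [X in `|X|]mxE [X in _ + X]mxE -/K => e1 e2 e3.
apply: ler_pM => //; rewrite (le_trans (ler_normD _ _))//; lra.
Qed.

Lemma innovation_le y v r j l : enorm y <= r ->
  `|(row j y - h (row (lift ord0 j) v)) ord0 l|
    <= r + enorm (h (row (lift ord0 j) v)).
Proof.
move=> yr; rewrite !mxE (le_trans (ler_normB _ _))// lerD ?ler_coord_enorm//.
exact: le_trans (ler_coord_enorm _ _ _) yr.
Qed.

Lemma obs_growth_ge0 v : 0 <= obs_growth h v.
Proof. by apply: sumr_ge0 => j _; rewrite addr_ge0// sqr_ge0. Qed.

Lemma sqr_enorm_obs_le v (j : 'I_J) :
  enorm (h (row (lift ord0 j) v)) ^+ 2 <= obs_growth h v.
Proof.
rewrite /obs_growth (bigD1 j)//= -addrA addrCA lerDl addr_ge0//.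
by apply: sumr_ge0 => i _; rewrite addr_ge0// sqr_ge0.
Qed.

Lemma misfit_le y v r : enorm y <= r ->
  misfit h Gamma y v
    <= m%:R * K ^+ 2 * J%:R * (r ^+ 2 + 1) * (1 + obs_growth h v).
Proof.
move=> yr; set x := fun j : 'I_J => enorm (h (row (lift ord0 j) v)).
have xo j : x j ^+ 2 <= obs_growth h v by exact: sqr_enorm_obs_le.
have -> : m%:R * K ^+ 2 * J%:R * (r ^+ 2 + 1) * (1 + obs_growth h v) =
    \sum_(j < J) m%:R * K ^+ 2 * ((r ^+ 2 + 1) * (1 + obs_growth h v)).
  by rewrite sumr_const card_ord -mulr_natr; ring.
apply: ler_sum => j _.
have := wnorm_sqr_le (innovation_le v j ^~ yr).
rewrite -/(x j) => /(ler_wpM2l (ltW (_ : 0 < 2^-1))) - /(_ _)/le_trans; apply => //.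
have -> : 2^-1 * (m%:R * ((r + x j) * K) ^+ 2) =
  m%:R * K ^+ 2 * (2^-1 * (r + x j) ^+ 2) by ring.
rewrite ler_wpM2l ?mulr_ge0 ?sqr_ge0 ?exprn_ge0 ?mx_l1_ge0//.
(* The bound is (r + x)^2 / 2 <= r^2 + x^2 with x^2 <= w, where w is the value of [obs_growth]. *)
have := xo j; have := sqr_ge0 r; have := sqr_ge0 (r - x j).
have := mulr_ge0 (sqr_ge0 r) (obs_growth_ge0 v).
move: (obs_growth h v) (x j) => w z *; lra.
Qed.

(* The factor f is absorbed by AM-GM, which is why f ^+ 2 enters the bound. *)
Lemma misfit_dist y y' v r f : enorm y <= r -> enorm y' <= r ->
  `|f| * `|misfit h Gamma y v - misfit h Gamma y' v| <=
  m%:R * K ^+ 2 * J%:R * (r ^+ 2 + 1) * enorm (y - y')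
    * (f ^+ 2 + (1 + obs_growth h v)).
Proof.
move=> yr y'r; set x := fun j : 'I_J => enorm (h (row (lift ord0 j) v)).
have xo j : x j ^+ 2 <= obs_growth h v by exact: sqr_enorm_obs_le.
set s := enorm (y - y').
have -> : m%:R * K ^+ 2 * J%:R * (r ^+ 2 + 1) * s * (f ^+ 2 + (1 + obs_growth h v)) =
    \sum_(j < J) m%:R * K ^+ 2 * s * ((r ^+ 2 + 1) * (f ^+ 2 + (1 + obs_growth h v))).
  by rewrite sumr_const card_ord -mulr_natr; ring.
rewrite /misfit -sumrB (le_trans (ler_wpM2l _ (ler_norm_sum _ _ _)))//.
rewrite mulr_sumr; apply: ler_sum => j _.
(* The term h(v_{j+1}) cancels between the two innovations, which leaves row j of y - y'. *)
have ab l : `|((row j y - h (row (lift ord0 j) v)) -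
    (row j y' - h (row (lift ord0 j) v))) ord0 l| <= s.
  rewrite opprB addrA subrK -linearB mxE; exact: ler_coord_enorm.
have := wnorm_sqr_dist (innovation_le v j ^~ yr) (innovation_le v j ^~ y'r) ab.
rewrite -/(x j) => H; rewrite -mulrBr normrM [`|2^-1|]ger0_norm// mulrCA.
apply: (@le_trans _ _ (2^-1 * (`|f| * (m%:R * ((s * K) * (2 * ((r + x j) * K))))))).
  by rewrite !ler_wpM2l.
have -> : 2^-1 * (`|f| * (m%:R * ((s * K) * (2 * ((r + x j) * K))))) =
   m%:R * K ^+ 2 * s * (`|f| * (r + x j)) by field.
rewrite ler_wpM2l ?mulr_ge0 ?mx_l1_ge0 ?exprn_ge0 ?enorm_ge0//.
(* Here |f| r <= (f^2 + r^2) / 2 and |f| x <= (f^2 + x^2) / 2, followed by x^2 <= w. *)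
have := xo j; have := obs_growth_ge0 v; have := sqr_ge0 r.
have := sqr_ge0 (`|f| - r); have := sqr_ge0 (`|f| - x j).
have := mulr_ge0 (sqr_ge0 r) (obs_growth_ge0 v).
rewrite -[f ^+ 2]real_normK ?num_real//; have := sqr_ge0 `|f|.
have := mulr_ge0 (sqr_ge0 r) (sqr_ge0 `|f|).
move: (obs_growth h v) (x j) `|f| => w z g *; lra.
Qed.

Lemma measurable_obs_growth : measurable_fun setT (@obs_growth R n m J h).
Proof.
apply: measurable_sum => j; apply: measurable_funD => //.
apply: measurable_funX; apply: measurableT_comp; first exact: measurable_enorm.
apply: measurableT_comp; last exact: measurable_row.
by apply: continuous_measurable_mx; exact: cts_fun.
Qed.

End misfit_bounds.

(** * Lipschitz continuity of the filtering means in the data *)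

Theorem corollary2p17 (R : realType) (n m J p : nat)
    (Psi : continuousType 'rV[R]_n 'rV[R]_n)
    (h : continuousType 'rV[R]_n 'rV[R]_m)
    (m0 : 'rV[R]_n) (C0 Sigma : 'M[R]_n) (Gamma : 'M[R]_m)
    (g : 'rV[R]_n -> 'rV[R]_p) :
  (0 < n)%N -> (0 < m)%N -> (0 < J)%N -> (0 < p)%N ->
  spdmx C0 -> spdmx Sigma -> spdmx Gamma ->
  ('E_(prior J Psi m0 C0 Sigma)[obs_growth h] < +oo)%E ->
  measurable_fun [set: 'rV[R]_n] g ->
  ('E_(prior J Psi m0 C0 Sigma)[fun v => (enorm (g (row ord_max v)) ^+ 2)%R]
    < +oo)%E ->
  forall r : R, 0 < r ->
  exists2 c : R, 0 < c &
    forall y y' : 'M[R]_(J, m), enorm y < r -> enorm y' < r ->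
      enorm (vexpectation (filtering Psi h m0 C0 Sigma Gamma y) g -
             vexpectation (filtering Psi h m0 C0 Sigma Gamma y') g)
      <= c * enorm (y - y').
Proof.
move=> _ _ _ _ spdC spdS _ Ew mg Eg r r0.
pose P := prior J Psi m0 C0 Sigma.
pose w (v : 'M[R]_(J.+1, n)) := obs_growth h v.
pose G (v : 'M[R]_(J.+1, n)) := enorm (g (row ord_max v)) ^+ 2.
have mG : measurable_fun setT G.
  apply: measurable_funX; apply: measurableT_comp; first exact: measurable_enorm.
  by apply: (measurableT_comp mg); exact: measurable_row.
have intw : P.-integrable setT (EFin \o w).
  apply/integrableP; split.
    by apply/measurable_EFinP; exact: measurable_obs_growth.
  move: Ew; rewrite unlock; apply: le_lt_trans; rewrite le_eqVlt.
  by under eq_integral do rewrite /= ger0_norm ?obs_growth_ge0//; rewrite eqxx.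
have intG : P.-integrable setT (EFin \o G).
  apply/integrableP; split; first exact/measurable_EFinP.
  move: Eg; rewrite unlock; apply: le_lt_trans; rewrite le_eqVlt.
  by under eq_integral do rewrite /= ger0_norm ?sqr_ge0//; rewrite eqxx.
(* One dominating function for all uses: D >= 1, D >= |F_i|, and f^2 + (1 + w) <= D both for f = F_i
   and for f = 1. *)
pose D v := (1 + G v) + (1 + w v).
have int1 : P.-integrable setT (EFin \o cst (1 : R)).
  by apply: finite_measure_integrable_cst.
have intD : P.-integrable setT (EFin \o D).
  exact: (integrableD measurableT (integrableD measurableT int1 intG)
    (integrableD measurableT int1 intw)).
have D1 v : 1 <= D v.
  have := obs_growth_ge0 h v; have : 0 <= G v by exact: sqr_ge0.
  rewrite /D /w => *; lra.
pose f (i : 'I_p) (u : 'rV[R]_n) := g u ord0 i.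
pose F i (v : 'M[R]_(J.+1, n)) := f i (row ord_max v).
have mf i : measurable_fun setT (f i).
  exact: (measurableT_comp (@measurable_coord_mx R 1 p ord0 i) mg).
have mF i : measurable_fun setT (F i).
  by apply: (measurableT_comp (mf i)); exact: measurable_row.
have FG i v : F i v ^+ 2 <= G v.
  rewrite /G -[leLHS]real_normK ?num_real// ler_sqr ?nnegrE ?enorm_ge0//.
  exact: ler_coord_enorm.
have FD i v : `|F i v| <= D v.
  have := obs_growth_ge0 h v; have := FG i v; have := sqr_ge0 (`|F i v| - 1).
  rewrite -[F i v ^+ 2]real_normK ?num_real// /D /w; have := sqr_ge0 `|F i v|.
  move: `|F i v| => a *; lra.
pose K := mx_l1 (invmx (sqrtmx Gamma)).
(* B is the constant shared by [misfit_le] and [misfit_dist]. *)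
pose B := m%:R * K ^+ 2 * J%:R * (r ^+ 2 + 1).
have B0 : 0 <= B.
  by rewrite /B !mulr_ge0 ?exprn_ge0 ?mx_l1_ge0// addr_ge0 ?sqr_ge0.
(* Since the misfit is at most B D whenever |y| < r, z bounds every such evidence from below,
   uniformly in y. *)
pose z := \int[P]_v expR (- (B * D v)).
have mD : measurable_fun setT D.
  by have /integrableP[/measurable_EFinP] := intD.
have D1' v : `|cst 1 v : R| <= D v by rewrite normr1.
have intexp (phi : 'M[R]_(J.+1, n) -> R) :
    measurable_fun setT phi -> (forall v, 0 <= phi v) ->
    P.-integrable setT (EFin \o (fun v => expR (- phi v))).
  move=> mphi phi0.
  have := integrable_expRN intD (@measurable_cst _ _ _ _ setT (1 : R)) mphi phi0 D1'.
  by apply: eq_integrable => // v _ /=; rewrite mul1r.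
have mBD : measurable_fun setT (fun v => B * D v) by exact: measurable_funM.
have BD0 v : 0 <= B * D v by rewrite mulr_ge0// (le_trans _ (D1 v)).
have z0 : 0 < z.
  have PT : (0 < P setT)%E.
    by have -> : P setT = 1%E by exact: probability_setT.
  apply: fine_gt0; apply/andP; split.
    by apply: integral_pos_gt0 PT (measurable_expRN mBD) _ => v; exact: expR_gt0.
  have /integrableP[_] := intexp _ mBD BD0; apply: le_lt_trans.
  rewrite le_eqVlt; apply/orP; left; apply/eqP; apply: eq_integral => v _.
  by rewrite /= ger0_norm ?expR_ge0.
have mphi y : measurable_fun setT (@misfit R n m J h Gamma y).
  exact: measurable_misfit.
have phi0 y v := @misfit_ge0 R n m J h Gamma y v.
have Zz y : enorm y < r -> z <= \int[P]_v expR (- misfit h Gamma y v).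
  move=> yr; apply: le_Rintegral => //; [exact: intexp|exact: intexp|].
  move=> v _; rewrite ler_expR lerN2.
  rewrite (le_trans (misfit_le h Gamma v (ltW yr)))// ler_wpM2l//.
  by rewrite lerDr addr_ge0// sqr_ge0.
have Uoo : (gibbs_measure (@prior_potential R n J Psi m0 C0 Sigma) setT < +oo)%E.
  exact: prior_evidence_lty.
(* The filtering mean is pulled back along v -> v_J to a posterior mean, which is then written as a
   ratio of prior integrals. *)
have meanE y i : (vexpectation (filtering Psi h m0 C0 Sigma Gamma y) g) ord0 i =
    (\int[P]_v (F i v * expR (- misfit h Gamma y v))) /
    (\int[P]_v expR (- misfit h Gamma y v)).
  set Z := \int[P]_v expR (- misfit h Gamma y v).
  have postE (k : 'M[R]_(J.+1, n) -> R) : measurable_fun setT k ->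
      (\int[posterior Psi h m0 C0 Sigma Gamma y]_v (k v)%:E =
       \int[P]_v (k v * (expR (- misfit h Gamma y v) / Z))%:E)%E.
    exact: (integral_gibbs_add
      (V := @prior_potential R n J Psi m0 C0 Sigma \+ misfit h Gamma y)
      Uoo (mphi y) (phi0 y) (fun v => erefl)).
  have intFe : P.-integrable setT
      (EFin \o (fun v => F i v * expR (- misfit h Gamma y v))).
    exact: (integrable_expRN intD (mF i) (mphi y) (phi0 y) (FD i)).
  have intFp : P.-integrable setT
      (EFin \o (fun v => F i v * (expR (- misfit h Gamma y v) / Z))).
    have := integrableZr measurableT Z^-1 intFe.
    by apply: eq_integrable => // v _ /=; rewrite -EFinM mulrA.
  rewrite mxE unlock /filtering integral_distribution//=; last 2 first.
  - by apply/measurable_EFinP; exact: mf.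
  (* The change of variables requires F_i to be integrable under the posterior; this is read off the
     prior through [postE]. *)
  - apply/integrableP; split; first by apply/measurable_EFinP; exact: mF.
    under eq_integral do rewrite /= -[X in X%:E]/(`|F i _|).
    rewrite postE; last by apply: measurableT_comp => //; exact: measurable_norm.
    have /integrableP[_] := intFp; apply: le_lt_trans.
    rewrite le_eqVlt; apply/orP; left; apply/eqP; apply: eq_integral => v _.
    rewrite /= normrM [`|_ / Z|]ger0_norm// divr_ge0 ?expR_ge0//.
    by apply: Rintegral_ge0 => u _; exact: expR_ge0.
  transitivity (\int[P]_v (F i v * expR (- misfit h Gamma y v) * Z^-1)).
    rewrite (postE _ (mF i)); congr fine; apply: eq_integral => v _.
    by rewrite mulrA.
  by rewrite RintegralZr.
pose M := \int[P]_v D v.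
pose C := B * (M / z + M ^+ 2 / z ^+ 2).
have M0 : 0 <= M by apply: Rintegral_ge0 => v _; exact: le_trans (D1 v).
have C0_ge0 : 0 <= C.
  by rewrite mulr_ge0// addr_ge0// divr_ge0 ?exprn_ge0// ltW.
(* C is the Lipschitz constant of one coordinate of the mean. It is only known to be nonnegative, so
   1 is added to make c positive. *)
exists (p%:R * C + 1) => [|y y' yr y'r]; first by rewrite ltr_wpDl// mulr_ge0.
set s := enorm (y - y').
have s0 : 0 <= s := enorm_ge0 _.
apply: (@le_trans _ _ (p%:R * C * s)); last by rewrite ler_wpM2r// lerDl.
(* Bounding the Euclidean norm by the sum of the p coordinates costs the factor p. *)
rewrite (le_trans (enorm_le_l1 _))// /mx_l1 big_ord1.
have -> : p%:R * C * s = \sum_(i < p) C * s.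
  by rewrite sumr_const card_ord -mulrA mulr_natl.
have mxBE (a b : 'rV[R]_p) i : (a - b) ord0 i = a ord0 i - b ord0 i.
  by rewrite !mxE.
apply: ler_sum => i _; rewrite mxBE.
rewrite (congr2 (fun a b => a - b) (meanE y i) (meanE y' i)).
have -> : C * s = (B * s) * (M / z + M ^+ 2 / z ^+ 2) by rewrite /C; ring.
apply: (ler_dist_tilted_mean intD (mF i) (mphi y) (mphi y') (phi0 y) (phi0 y')
  D1 (FD i) _ _ z0 (Zz _ yr) (Zz _ y'r)).
(* The weight F_i handles the numerators; the weight 1, in the next bullet, handles the
   denominators. *)
- move=> v; have := misfit_dist h Gamma v (F i v) (ltW yr) (ltW y'r).
  move=> /le_trans; apply; rewrite -/B -/s.
  apply: ler_wpM2l; first exact: mulr_ge0.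
  by rewrite /D lerD2r (le_trans (FG i v))// lerDr.
- move=> v; have := misfit_dist h Gamma v 1 (ltW yr) (ltW y'r).
  rewrite normr1 mul1r => /le_trans; apply; rewrite -/B -/s.
  apply: ler_wpM2l; first exact: mulr_ge0.
  by rewrite /D lerD2r expr1n lerDl sqr_ge0.
Qed.
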